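(* Let $m>1$ be an integer and let $F$ be a bipartite directed $2$-factor of order $2m$. There exists an $F$-factorization of $H_{2m}^*$.
   Context: A directed $2$-factor $[m_1,\ldots,m_t]$ of order $m_1+\cdots+m_t$ is a digraph consisting of vertex-disjoint directed cycles of lengths $m_1,\ldots,m_t$ (each $m_i\ge2$; a directed $2$-cycle on $\{u,v\}$ consists of arcs $uv$ and $vu$); it is bipartite if all $m_i$ are even. $H_{2m}$ is the lexicographic product $C_m[\overline{K_2}]$: vertex set $\{x_i,y_i : i\in\mathbb{Z}_m\}$, with each of $x_i,y_i$ adjacent to each of $x_{i+1},y_{i+1}$ (indices mod $m$), $C_m$ being the cycle on $\mathbb{Z}_m$. For a graph $G$, $G^*$ is the digraph obtained by replacing each edge $\{u,v\}$ by the arcs $uv$ and $vu$. An $F$-factorization of a digraph $D$ is a partition of the arc set of $D$ into spanning subdigraphs each isomorphic to $F$. *)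

(* Defs.v *)
From mathcomp Require Import all_boot all_algebra.

Set Implicit Arguments.
Unset Strict Implicit.
Unset Printing Implicit Defensive.

Import GRing.Theory.

(* A simple graph is given by its (symmetric, irreflexive) adjacency relation,
   a digraph on the finite vertex type T by its arc set, a {set T * T}; all
   elements of T are vertices, so a subset of the arc set of a digraph is
   exactly a spanning subdigraph of it. *)
Notation digraph T := {set T * T}.

Definition digraph_iso (T V : finType) (F : digraph T) (D : digraph V) : Prop :=
  exists2 f : T -> V, bijective f &
    forall x y : T, ((x, y) \in F) = ((f x, f y) \in D).

(* The cycles are listed as the sequences c of their vertices in cyclic order,
   the arcs of c being the pairs (x, next c x); for c = [:: u; v] these are
   the two arcs uv and vu. *)
Definition directed_2factor (T : finType) (ms : seq nat) (F : digraph T) : Prop :=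
  all (leq 2) ms /\
  exists cs : seq (seq T),
    [/\ perm_eq (flatten cs) (enum T),
        map size cs = ms &
        F = [set u | has (fun c => (u.1 \in c) && (u.2 == next c u.1)) cs]].

Definition bipartite_type (ms : seq nat) : bool := all (fun n => ~~ odd n) ms.

(* The cycle on Z_m for m > 1; for m = 2 this simple graph is a single edge. *)
Definition cycle_graph (m : nat) : rel 'Z_m :=
  [rel i j | (j == i + 1)%R || (i == j + 1)%R].

Definition empty_graph (V : finType) : rel V := [rel _ _ | false].

Definition lex_product (V W : finType) (G : rel V) (H : rel W) : rel (V * W) :=
  [rel u v | G u.1 v.1 || (u.1 == v.1) && H u.2 v.2].

(* The vertices x_i and y_i are (i, false) and (i, true). *)
Definition H2m (m : nat) : rel ('Z_m * bool) :=
  lex_product (@cycle_graph m) (@empty_graph bool).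

Definition symmetric_digraph (V : finType) (G : rel V) : digraph V :=
  [set u | G u.1 u.2].

Definition factorization (T V : finType) (F : digraph T) (D : digraph V)
    (P : {set digraph V}) : Prop :=
  partition P D /\ (forall A : digraph V, A \in P -> digraph_iso F A).

(* Main.v *)
(* Put 0 = s_0 < s_1 < ... < s_t = m, the partial sums of the half-lengths of
   the cycles, as cut levels on Z_m. For a labelling a : Z_m -> bool, let the
   vertex (j, a j) move up to (j + 1, a (j + 1)) and the other vertex of level j
   move down to (j - 1, ~~ a (j - 1)), with the two roles exchanged at the cut
   levels, where the walk thus turns back. Between consecutive cuts s and s + k
   this gives one directed cycle, made of one vertex of each of the two cut
   levels and both vertices of the levels in between, of length 2k.
   The arcs between levels j and j + 1 used for a are determined by a j and
   a (j + 1), so a family of labellings decomposes H_2m^* as soon as, for every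
   j, the pair (a j, a (j + 1)) takes each of its four values exactly once.
   For m > 2 this is achieved by the labellings indexed by (p, q) in bool^2
   whose value at each level is p, q or p (+) q according to a proper
   3-colouring of the cycle Z_m. For m = 2 the levels j - 1 and j + 1 coincide,
   and two labellings suffice. *)

Require Import Defs.
From mathcomp Require Import all_boot all_algebra.
From mathcomp Require Import zify.

Set Implicit Arguments.
Unset Strict Implicit.
Unset Printing Implicit Defensive.

Import GRing.Theory.

(** * Directed 2-factors as lists of cycles *)

(** Both lists of cycles have the same sizes, so matching vertices by position in the flattened
    lists carries cycles onto cycles. *)
Lemma directed_2factor_iso (T V : finType) (ms : seq nat)
    (F : digraph T) (D : digraph V) :
  directed_2factor ms F -> directed_2factor ms D -> digraph_iso F D.
Proof.
move=> [_ [cs [Ecs szcs ->]]] [_ [ds [Eds szds ->]]].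
have Ucs : uniq (flatten cs) by rewrite (perm_uniq Ecs) enum_uniq.
have Uds : uniq (flatten ds) by rewrite (perm_uniq Eds) enum_uniq.
have inT x : x \in flatten cs by rewrite (perm_mem Ecs) mem_enum.
have inV y : y \in flatten ds by rewrite (perm_mem Eds) mem_enum.
have Esz : size (flatten cs) = size (flatten ds).
  by rewrite !size_flatten /shape szcs szds.
have [f [g [fK gK fE]]] : exists f : T -> V, exists g : V -> T,
    [/\ cancel f g, cancel g f & map f (flatten cs) = flatten ds].
  case: (pickP T) => [t0 _|T0]; last first.
    have T_empty (x : T) : False by have := T0 x.
    have cs0 : flatten cs = [::] by case: flatten => // x; case: (T_empty x).
    have ds0 : flatten ds = [::] by apply: size0nil; rewrite -Esz cs0.
    have V_empty (y : V) : False by have := inV y; rewrite ds0.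
    exists (fun x => False_rect V (T_empty x)).
    exists (fun y => False_rect T (V_empty y)).
    by split=> [x|y|]; [case: (T_empty x) | case: (V_empty y) | rewrite cs0 ds0].
  have v0 : V by move: Esz (inT t0); case: (flatten cs); case: (flatten ds).
  exists (fun x => nth v0 (flatten ds) (index x (flatten cs))).
  exists (fun y => nth t0 (flatten cs) (index y (flatten ds))).
  split=> [x|y|].
  - by rewrite index_uniq ?nth_index // -Esz index_mem.
  - by rewrite index_uniq ?nth_index // Esz index_mem.
  - apply: (@eq_from_nth _ v0); rewrite ?size_map // => i lti.
    by rewrite (nth_map t0) // index_uniq.
have finj := can_inj fK.
have Eds' : ds = map (map f) cs.
  apply: eq_from_flatten_shape; first by rewrite -map_flatten.
  rewrite /shape szds -szcs -map_comp; apply: eq_map => c /=.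
  by rewrite size_map.
exists f; first by exists g.
move=> x y; rewrite !inE Eds' has_map; apply: eq_in_has => c c_in /=.
rewrite mem_map // next_map ?inj_eq //.
case/splitPr: c_in Ucs => cs1 cs2.
by rewrite flatten_cat /= cat_uniq cat_uniq => /and4P[_ _ -> _].
Qed.

Lemma fcycles_2factor (V : finType) (ms : seq nat) (s : V -> V)
    (cs : seq (seq V)) :
    all (leq 2) ms -> map size cs = ms -> perm_eq (flatten cs) (enum V) ->
    all (fcycle s) cs ->
  directed_2factor ms [set u | u.2 == s u.1].
Proof.
move=> ms2 szcs Ecs /allP cycs; split=> //; exists cs; split=> //.
apply/setP=> -[x y]; rewrite !inE /=.
have nextE c : c \in cs -> x \in c -> next c x = s x.
  by move=> /cycs cyc_c xc; apply/esym/eqP/(next_cycle cyc_c xc).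
have /flattenP[c cin xc] : x \in flatten cs by rewrite (perm_mem Ecs) mem_enum.
apply/eqP/hasP=> [->|[d din /andP[xd /eqP ->]]]; last exact: nextE.
by exists c; rewrite // xc nextE //=.
Qed.

(** * Cut levels and the cycles between them *)

Lemma mem_scanl_addn i j ks : j \in scanl addn i ks -> (i <= j)%N.
Proof.
elim: ks i => //= k ks IHks i; rewrite inE => /predU1P[->|/IHks]; lia.
Qed.

Lemma mem_scanl_sumn i ks : i + sumn ks \in i :: scanl addn i ks.
Proof.
elim: ks i => /= [|k ks IHks] i; first by rewrite addn0 inE.
by rewrite addnA in_cons IHks orbT.
Qed.

Section Model.

Variables (m : nat) (b : pred 'Z_m).
Local Open Scope ring_scope.

(* The out-neighbour of [u] in the factor given by [a], the set of cut levels
   being [b]. *)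
Definition step (a : 'Z_m -> bool) (u : 'Z_m * bool) : 'Z_m * bool :=
  if u.2 (+) a u.1 == b u.1 then (u.1 + 1, a (u.1 + 1))
  else (u.1 - 1, ~~ a (u.1 - 1)).

Variable a : 'Z_m -> bool.

(** The vertex of level [j] that the walk enters from below if [d] is false, from above if [d] is
    true. As [j] is a natural number, [m] also names level 0. *)
Definition vtx (d : bool) (j : nat) : 'Z_m * bool := (j%:R, d (+) a j%:R).

Lemma step_up d j : b j%:R = d -> step a (vtx d j) = vtx false j.+1.
Proof. by move=> bj; rewrite /step /vtx /= addbK bj eqxx -natr1. Qed.

Lemma step_down d j : b j.+1%:R != d -> step a (vtx d j.+1) = vtx true j.
Proof.
by move=> bj; rewrite /step /vtx /= addbK eq_sym (negPf bj) -natr1 addrK.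
Qed.

(** At either end only the vertex where the walk turns back occurs: level [i + k] entered from
    below, level [i] from above. *)
Definition level_cycle (i k : nat) : seq ('Z_m * bool) :=
  [seq vtx false j | j <- iota i.+1 k] ++ [seq vtx true j | j <- rev (iota i k)].

(** The induction needs a general [d]: it is true at the cut level where the ascent starts, false
    afterwards. *)
Lemma up_path d i k :
    b i%:R = d -> (forall j, (i < j < i + k)%N -> ~~ b j%:R) ->
  fpath (step a) (vtx d i) [seq vtx false j | j <- iota i.+1 k].
Proof.
elim: k d i => //= k IHk d i bi nb; rewrite step_up // eqxx.
case: k => // k in IHk nb *; apply: IHk => [|j ltj].
  by apply: negPf; apply: nb; lia.
by apply: nb; lia.
Qed.

Lemma down_path d i k :
    b (i + k)%:R != d -> (forall j, (i < j < i + k)%N -> ~~ b j%:R) ->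
  fpath (step a) (vtx d (i + k)) [seq vtx true j | j <- rev (iota i k)].
Proof.
elim: k d => // k IHk d bi nb.
have -> : rev (iota i k.+1) = (i + k)%N :: rev (iota i k).
  by rewrite -[in LHS](addn1 k) iotaD rev_cat.
rewrite addnS /= step_down -?addnS // eqxx /=.
case: k => // k in IHk bi nb *; apply: IHk => [|j ltj].
  by rewrite eqb_id; apply: nb; lia.
by apply: nb; lia.
Qed.

Lemma level_cycleP i k : (0 < k)%N ->
    b i%:R -> b (i + k)%:R -> (forall j, (i < j < i + k)%N -> ~~ b j%:R) ->
  fcycle (step a) (level_cycle i k).
Proof.
case: k => // k _ bi bk nb.
have E : rev (iota i k.+1) = rcons (rev (iota i.+1 k)) i by rewrite /= rev_cons.
(* Rotating the last vertex, at level [i], to the front gives an ascent followed by a descent. *)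
rewrite /level_cycle E map_rcons -rcons_cat -(rotr_cycle 1) rotr1_rcons /=.
rewrite step_up // eqxx /= rcons_cat -map_rcons -E cat_path.
have := up_path bi nb; rewrite /= => /andP[_ ->] /=.
rewrite (last_map (vtx false)) -[last _ _]/(last i (iota i.+1 k.+1)).
have -> : last i (iota i.+1 k.+1) = (i + k.+1)%N.
  by rewrite -nth_last size_iota nth_iota // addSnnS.
by apply: down_path; rewrite ?bk.
Qed.

Lemma size_level_cycle i k : size (level_cycle i k) = k.*2.
Proof. by rewrite size_cat !size_map size_rev !size_iota addnn. Qed.

Fixpoint level_cycles (i : nat) (ks : seq nat) : seq (seq ('Z_m * bool)) :=
  if ks is k :: ks' then level_cycle i k :: level_cycles (i + k) ks' else [::].

Lemma level_cyclesP i ks : all (leq 1) ks ->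
    (forall j, (i <= j <= i + sumn ks)%N ->
       b j%:R = (j \in i :: scanl addn i ks)) ->
  all (fcycle (step a)) (level_cycles i ks).
Proof.
elim: ks i => //= k ks IHks i /andP[k_gt0 ks_gt0] bE; apply/andP; split.
  apply: level_cycleP => //; [by rewrite bE ?inE ?eqxx //; lia| |].
    by rewrite bE ?inE ?eqxx ?orbT //; lia.
  move=> j ltj; rewrite bE; last lia.
  rewrite !inE; apply/or3P=> -[/eqP||/mem_scanl_addn]; try lia.
apply: IHks => // j lej; rewrite bE; last lia.
by rewrite in_cons; case: eqP => //; lia.
Qed.

Lemma shape_level_cycles i ks :
  map size (level_cycles i ks) = map double ks.
Proof. by elim: ks i => //= k ks IHks i; rewrite size_level_cycle IHks. Qed.

(** A cycle enters levels [i + 1] to [i + k] from below and [i] to [i + k - 1] from above, whence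
    the shift by [~~ d]. *)
Lemma mem_level_cycles i ks d j : (i + ~~ d <= j < i + sumn ks + ~~ d)%N ->
  vtx d j \in flatten (level_cycles i ks).
Proof.
elim: ks i => /= [|k ks IHks] i ltj; first lia.
rewrite mem_cat; have [ltjk|lekj] := ltnP j (i + k + ~~ d); last first.
  by rewrite IHks ?orbT //; lia.
apply/orP; left; rewrite mem_cat; case: d {IHks} ltj ltjk => /= ltj ltjk.
  by apply/orP; right; rewrite map_f // mem_rev mem_iota; lia.
by apply/orP; left; rewrite map_f // mem_iota; lia.
Qed.

End Model.

(** * The 2-factor given by one labelling *)

Definition cuts (m : nat) (ks : seq nat) : pred 'Z_m :=
  fun z => (z : nat) \in 0 :: scanl addn 0 ks.

Lemma step_2factor (m : nat) (ks : seq nat) (a : 'Z_m -> bool) :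
    1 < m -> all (leq 1) ks -> sumn ks = m ->
  directed_2factor (map double ks) [set u | u.2 == step (cuts ks) a u.1].
Proof.
move=> m_gt1 ks_gt0 sum_ks.
have cut_nat j : j <= m -> cuts ks (j%:R : 'Z_m)%R = (j \in 0 :: scanl addn 0 ks).
  move=> lejm; rewrite /cuts val_Zp_nat //.
  have [ltjm|] := ltnP j m; first by rewrite modn_small.
  move=> lemj; have -> : j = m by lia.
  by rewrite modnn mem_head -[X in X \in _]sum_ks (mem_scanl_sumn 0).
apply: (@fcycles_2factor _ _ _ (level_cycles a 0 ks)).
- by rewrite all_map; apply: sub_all ks_gt0 => k /=; lia.
- exact: shape_level_cycles.
(* All vertices occur and the total length is 2m, so none occurs twice. *)
- have sub : {subset enum {: 'Z_m * bool} <= flatten (level_cycles a 0 ks)}.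
    move=> [z c] _; have ltz : z < m by rewrite -[X in _ < X](Zp_cast m_gt1).
    pose d := c (+) a z.
    (* Level 0 entered from below is the end of the last cycle, at level [m]. *)
    pose j : nat := if d || (0 < z) then (z : nat) else m.
    have Ej : (j%:R = z :> 'Z_m)%R.
      apply: ord_inj; rewrite val_Zp_nat // /j.
      case: ifP => [_|]; first by rewrite modn_small.
      by rewrite modnn => /norP[_]; lia.
    have -> : (z, c) = vtx a d j by rewrite /vtx Ej /d -addbA addbb addbF.
    apply: mem_level_cycles; rewrite sum_ks /j.
    by case: (d) => /=; case: ltnP => /=; lia.
  have sz : size (flatten (level_cycles a 0 ks)) <= size (enum {: 'Z_m * bool}).
    rewrite size_flatten /shape shape_level_cycles.
    rewrite -cardE card_prod card_bool card_ord Zp_cast // -sum_ks.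
    by elim: (ks) => //= k l; lia.
  have U := leq_size_uniq (enum_uniq _) sub sz.
  apply: uniq_perm; rewrite ?enum_uniq // => u; rewrite mem_enum inE.
  by rewrite sub ?mem_enum.
- apply: level_cyclesP => // j lej; apply: cut_nat; lia.
Qed.

(** * Labellings that use each arc once *)

Lemma H2mE (m : nat) (u v : 'Z_m * bool) :
  H2m u v = (v.1 == u.1 + 1)%R || (u.1 == v.1 + 1)%R.
Proof. by rewrite /H2m /lex_product /= andbF orbF. Qed.

Lemma step_adjacent (m : nat) (b : pred 'Z_m) (a : 'Z_m -> bool) u :
  H2m u (step b a u).
Proof.
rewrite H2mE /step; case: ifP => _ /=.
  by rewrite eqxx.
by rewrite subrK eqxx orbT.
Qed.

(* The three functions f.1, f.2 and f.1 (+) f.2 of f are pairwise independent: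
   any two of them determine f. *)
Definition color_label (m : nat) (col : 'Z_m -> option bool)
    (f : bool * bool) (z : 'Z_m) : bool :=
  if col z is Some e then if e then f.2 else f.1 else f.1 (+) f.2.

Lemma color_label_unique (m : nat) (col : 'Z_m -> option bool) (i j : 'Z_m)
    (c d : bool) : col i != col j ->
  exists! f, color_label col f i = c /\ color_label col f j = d.
Proof.
rewrite /color_label.
case: (col i) => [[]|]; case: (col j) => [[]|] //= _.
- exists (d, c); split=> // -[p q] /= [-> ->] //.
- exists (c (+) d, c); split=> [|[p q] /= [-> <-]]; last by rewrite addbC addbK.
  by rewrite /= addbAC addbb.
- by exists (c, d); split=> // -[p q] /= [-> ->].
- exists (c, c (+) d); split=> [|[p q] /= [-> <-]]; last by rewrite addKb.
  by rewrite /= addKb.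
- exists (c (+) d, d); split=> [|[p q] /= [<- ->]]; last by rewrite addbK.
  by rewrite /= addbK.
- exists (d, c (+) d); split=> [|[p q] /= [<- ->]]; last by rewrite addbAC addbb.
  by rewrite /= addbC addbK.
Qed.

Lemma cycle_coloring (m : nat) : 1 < m ->
  exists col : 'Z_m -> option bool, forall z, col z != col (z + 1)%R.
Proof.
move=> m_gt1.
(* Parity colours the levels; for odd [m] the last one takes the third colour. *)
exists (fun z => if odd m && (z == m.-1 :> nat) then None else Some (odd z)).
move=> z; have ltz : z < m by rewrite -[X in _ < X](Zp_cast m_gt1).
have -> : (z + 1)%R = (z.+1 %% m) :> nat by rewrite -val_Zp_nat // -natr1 natr_Zp.
have [ltzm|] := ltnP z.+1 m.
  rewrite modn_small //=; case: (eqVneq (z : nat) m.-1) => [|_]; first lia.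
  by rewrite andbF; case: ifP => // _; rewrite (inj_eq Some_inj); case: odd.
move=> lemz; have -> : z = m.-1 :> nat by lia.
have -> : m.-1.+1 = m by lia.
rewrite modnn eqxx andbT /=; have -> : (0 == m.-1) = false by lia.
rewrite andbF; case: ifP => // modd.
by rewrite (inj_eq Some_inj); lia.
Qed.

Lemma unique_step_label (m : nat) (b : pred 'Z_m) : 1 < m ->
  exists (I : finType) (lab : I -> 'Z_m -> bool),
    forall u v, H2m u v -> exists! f, v = step b (lab f) u.
Proof.
move=> m_gt1; have [m2|mN2] := eqVneq m 2.
  (* Level 0 is labelled false and level 1 by [f], so the arc out of [(i, c)] always ends in the bit
     [f (+) c (+) b i]. *)
  exists bool, (fun f z => f && (z != 0%R)).
  subst m; move=> [i c] [j d]; rewrite H2mE /= => ij.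
  have down_up (k : 'Z_2) : (k - 1 = k + 1)%R.
    by congr (_ + _)%R; apply: val_inj.
  have -> : j = (i + 1)%R by case/orP: ij => /eqP-> //; rewrite -down_up addrK.
  have next_level : (i + 1 != 0)%R = (i == 0%R) by case: i {ij} => [[|[|]]].
  have stepE f : step b (fun z => f && (z != 0%R)) (i, c)
      = ((i + 1)%R, f (+) c (+) b i).
    rewrite /step /= down_up next_level.
    by case: (i == _); case: (b i); case: f; case: (c).
  exists (c (+) d (+) b i); split=> [|f]; rewrite stepE.
    by case: (b i); case: (c); case: (d).
  by case=> ->; case: (b i); case: (c); case: f.
have [col colP] := cycle_coloring m_gt1.
exists (bool * bool)%type, (color_label col).
have two_neq0 : (1 + 1 != 0 :> 'Z_m)%R.
  apply/eqP=> /(congr1 (@nat_of_ord _)); rewrite -[(1 + 1)%R]/(2%:R)%R val_Zp_nat //.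
  by rewrite modn_small //; lia.
have up_neq_down (i : 'Z_m) : (i + 1 != i - 1)%R.
  by rewrite -subr_eq0 opprB addrC addrA subrK.
(* As [i + 1] and [i - 1] differ, only one branch of [step] can give the arc; it prescribes the
   labels at two levels of distinct colours. *)
move=> [i c] [j d]; rewrite H2mE /= => /orP[] /eqP ij.
- subst j; have [f [[fi fj] fU]] :=
    color_label_unique (c (+) b i) d (colP i).
  exists f; split=> [|g].
    by rewrite /step /= fi addKb eqxx fj.
  rewrite /step /=; case: ifP => [/eqP gi|_] /eqP; rewrite xpair_eqE; last first.
    by rewrite (negPf (up_neq_down i)).
  by case/andP=> _ /eqP gj; apply: fU; rewrite -gi addKb gj.
- subst i; have [f [[fj fi] fU]] :=
    color_label_unique (~~ d) (~~ (c (+) b (j + 1)%R)) (colP j).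
  exists f; split=> [|g].
    by rewrite /step /= fi addbN addKb addrK fj negbK; case: (b _).
  rewrite /step /=; case: ifP => [_|gi] /eqP; rewrite xpair_eqE.
    by rewrite -[X in X == _](addrK 1%R) eq_sym (negPf (up_neq_down _)).
  rewrite addrK => /andP[_ /eqP gj]; apply: fU; rewrite gj negbK; split=> //.
  by move: gi; case: (color_label _ _ _); case: (b _); case: (c).
Qed.

(** * The factorization *)

Theorem theorem3p4 (m : nat) (hm : 1 < m) (T : finType) (ms : seq nat)
    (F : digraph T) (hF : directed_2factor ms F) (hbip : bipartite_type ms)
    (hord : sumn ms = 2 * m) :
  exists P : {set digraph ('Z_m * bool)%type},
    factorization F (symmetric_digraph (@H2m m)) P.
Proof.
have [ms2 _] := hF.
pose ks := map half ms.
have Ems : ms = map double ks.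
  rewrite -map_comp -[LHS]map_id; apply/eq_in_map => n n_in /=.
  by rewrite even_halfK // (allP hbip).
have ks_gt0 : all (leq 1) ks.
  by rewrite all_map; apply: sub_all ms2 => n /=; lia.
have sum_ks : sumn ks = m.
  suff: sumn ms = (sumn ks).*2 by lia.
  by rewrite Ems; elim: (ks) => //= k l ->; lia.
have [I [lab labP]] := unique_step_label (@cuts m ks) hm.
pose D f : digraph ('Z_m * bool)%type :=
  [set u | u.2 == step (cuts ks) (lab f) u.1].
have DH u f : u \in D f -> H2m u.1 u.2.
  by rewrite inE => /eqP ->; apply: step_adjacent.
exists [set D f | f : I]; split; last first.
  move=> _ /imsetP[f _ ->]; apply: directed_2factor_iso hF _.
  by rewrite Ems; apply: step_2factor.
apply/and3P; split.
- apply/eqP/setP=> u; rewrite inE; apply/bigcupP/idP.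
    by case=> _ /imsetP[f _ ->] /DH.
  move=> /labP[f [Ef _]]; exists (D f); first exact: imset_f.
  by rewrite inE Ef.
- apply/trivIsetP=> _ _ /imsetP[f _ ->] /imsetP[g _ ->]; apply: contraNT.
  (* A common arc forces both indices to be the one given by [labP]. *)
  case/pred0Pn=> u /andP[/= uf ug].
  have [h [_ hU]] := labP _ _ (DH _ _ uf).
  move: uf ug; rewrite !inE => /eqP/hU <- /eqP/hU <-.
  by rewrite eqxx.
- apply/imsetP=> -[f _ Df].
  move/setP/(_ ((0%R, true), step (cuts ks) (lab f) (0%R, true))): Df.
  by rewrite !inE eqxx.
Qed.
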